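(* Let $(\gamma_n)_{n\in\mathbb{N}}$ be a non-increasing sequence of non-negative numbers, and let $$D:\ell^1(\mathbb{N})\to\ell^2(\mathbb{N}),\qquad D((\beta_n)_{n\in\mathbb{N}}):=(\beta_n\gamma_n)_{n\in\mathbb{N}}.$$ Then for $0<p\le1$ and $n\in\mathbb{N}$ we have $$a_n(D^p)=a_n(D),$$ where $D^p:\ell^p(\mathbb{N})\to\ell^2(\mathbb{N})$ is the restriction of $D$ to $\ell^p(\mathbb{N})$.
   Context: For a quasi-normed space $\mathcal{F}$, a normed space $X$ and a linear operator $T:\mathcal{F}\to X$, the $n$th approximation number is $a_n(T)=\inf_{\mathrm{rank}\,A\le n}\ \sup_{\|f\|_{\mathcal{F}}\le1}\|Tf-Af\|_X$, where the infimum runs over all bounded linear operators $A:\mathcal{F}\to X$ of rank at most $n$. $\ell^p(\mathbb{N})$ carries its usual (quasi-)norm. *)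

(* Defs.v *)
From HB Require Import structures.
From mathcomp Require Import all_boot all_order all_algebra.
From mathcomp Require Import complex.
From mathcomp Require Import all_classical all_reals all_analysis.

Set Implicit Arguments.
Unset Strict Implicit.
Unset Printing Implicit Defensive.

Import Order.TTheory GRing.Theory Num.Theory.

Local Open Scope classical_set_scope.
Local Open Scope ring_scope.

(* The scalar field is R or C; both cases are treated at once, the modulus
   being valued in R in either case. *)
Variant scalar_kind := RealScalars | ComplexScalars.

Definition scalars (R : realType) (s : scalar_kind) : numFieldType :=
  match s with
  | RealScalars => R
  | ComplexScalars => R[i]
  end.

Definition of_real (R : realType) (s : scalar_kind) : R -> scalars R s :=
  match s return R -> scalars R s with
  | RealScalars => fun x => x
  | ComplexScalars => fun x => (x%:C)%C
  end.

Definition modulus (R : realType) (s : scalar_kind) : scalars R s -> R :=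
  match s return scalars R s -> R with
  | RealScalars => fun x => `|x|
  | ComplexScalars => fun z => Normc.normc z
  end.

Arguments of_real {R} s x.
Arguments modulus {R s} x.

Section modulus_theory.
Context {R : realType} {s : scalar_kind}.
Implicit Types x y : scalars R s.

Lemma modulus_ge0 x : 0 <= modulus x.
Proof. by case: s x => //= -[a b]; exact: sqrtr_ge0. Qed.

Lemma modulus0 : modulus (0 : scalars R s) = 0.
Proof. by case: s => /=; [exact: normr0 | exact: Normc.normc0]. Qed.

Lemma modulus_eq0 x : modulus x = 0 -> x = 0.
Proof. by case: s x => /= x; [exact: normr0_eq0 | exact: Normc.eq0_normc]. Qed.

Lemma modulusM x y : modulus (x * y) = modulus x * modulus y.
Proof. by case: s x y => /= x y; [exact: normrM | exact: Normc.normcM]. Qed.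

Lemma ler_modulusD x y : modulus (x + y) <= modulus x + modulus y.
Proof. by case: s x y => /= x y; [exact: ler_normD | exact: le_normcD]. Qed.

Lemma modulus_of_real (r : R) : modulus (of_real s r) = `|r|.
Proof. by case: s => //=; rewrite expr0n addr0 sqrtr_sqr. Qed.

End modulus_theory.

HB.mixin Record isQuasiNormed (R : realType) (s : scalar_kind) V
    of GRing.Lmodule (scalars R s) V := {
  qnorm : V -> R;
  qnorm_ge0 : forall x, 0 <= qnorm x;
  qnorm_eq0 : forall x, qnorm x = 0 -> x = 0;
  qnormZ : forall a x, qnorm (a *: x) = modulus a * qnorm x;
  qnormD : exists C : R, forall x y, qnorm (x + y) <= C * (qnorm x + qnorm y)
}.

#[short(type="quasiNormedType")]
HB.structure Definition QuasiNormed (R : realType) (s : scalar_kind) :=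
  {V of isQuasiNormed R s V & GRing.Lmodule (scalars R s) V}.

Section approximation_numbers.
Context {R : realType} {s : scalar_kind}.
Let K := scalars R s.

Definition has_dim (V : lmodType K) (S : set V) (m : nat) : Prop :=
  exists b : 'I_m -> V,
    [/\ forall i, S (b i),
        forall c : 'I_m -> K, \sum_(i < m) c i *: b i = 0 -> forall i, c i = 0
      & forall v, S v -> exists c : 'I_m -> K, v = \sum_(i < m) c i *: b i].

Definition rank_le (V W : lmodType K) (A : {linear V -> W}) (n : nat) : Prop :=
  exists2 m : nat, (m <= n)%N & has_dim (range A) m.

Definition bounded_operator (F X : quasiNormedType R s)
    (A : {linear F -> X}) : Prop :=
  exists C : R, forall f, qnorm (A f) <= C * qnorm f.

(* Normed spaces are the quasi-normed spaces whose quasi-norm satisfies the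
   triangle inequality, so the target X is allowed to be quasi-normed too. *)
Definition approx_number (F X : quasiNormedType R s)
    (T : {linear F -> X}) (n : nat) : \bar R :=
  ereal_inf [set ereal_sup [set (qnorm (T f - A f))%:E | f in [set f | qnorm f <= 1]]
            | A in [set A : {linear F -> X} | bounded_operator A /\ rank_le A n]].

End approximation_numbers.

Definition exp1 {R : realType} : {posnum R} := PosNum ltr01.
Definition exp2 {R : realType} : {posnum R} := PosNum (ltr0Sn R 1).

Section ellp.
Context (R : realType) (s : scalar_kind) (p : {posnum R}).
Let K := scalars R s.
Implicit Types x y : nat -> K^o.

Definition ellp_Lnorm x : \bar R :=
  Lnorm counting (p%:num)%:E (fun k => (modulus (x k))%:E).

Definition in_ellp : {pred nat -> K^o} := fun x => (ellp_Lnorm x < +oo)%E.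

Lemma ellp_LnormE x : ellp_Lnorm x =
  ((\sum_(k <oo) (modulus (x k) `^ p%:num)%:E) `^ (p%:num)^-1)%E.
Proof.
rewrite /ellp_Lnorm Lnorm_counting//; congr (_ `^ _)%E.
by apply: eq_eseriesr => k _; rewrite /= ger0_norm// modulus_ge0.
Qed.

Lemma in_ellpE x : (x \in in_ellp) =
  (\sum_(k <oo) (modulus (x k) `^ p%:num)%:E < +oo)%E.
Proof.
rewrite unfold_in /in_ellp ellp_LnormE; apply/idP/idP.
  by apply: lty_poweRy; rewrite invr_eq0.
exact: poweR_lty.
Qed.

Lemma powR_modulusD (a b : K) :
  modulus (a + b) `^ p%:num <=
  2 `^ p%:num * (modulus a `^ p%:num + modulus b `^ p%:num).
Proof.
pose M := Num.max (modulus a) (modulus b).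
have M0 : 0 <= M by rewrite le_max modulus_ge0.
apply: (@le_trans _ _ ((2 * M) `^ p%:num)).
  apply: ge0_ler_powR; rewrite ?nnegrE ?modulus_ge0 ?mulr_ge0//.
  apply: (le_trans (ler_modulusD _ _)).
  by rewrite mulr_natl mulr2n lerD// le_max lexx ?orbT.
rewrite powRM// ler_wpM2l ?powR_ge0// /M.
by case: (leP (modulus a)) => _; rewrite ?lerDl ?lerDr powR_ge0.
Qed.

Lemma ellp_sumD x y :
  (\sum_(k <oo) (modulus ((x + y) k) `^ p%:num)%:E <=
   (2 `^ p%:num)%:E * (\sum_(k <oo) (modulus (x k) `^ p%:num)%:E +
                       \sum_(k <oo) (modulus (y k) `^ p%:num)%:E))%E.
Proof.
rewrite -nneseriesD; try by move=> *; rewrite lee_fin powR_ge0.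
rewrite -nneseriesZl; last by move=> *; rewrite adde_ge0// lee_fin powR_ge0.
apply: lee_nneseries => k *; first by rewrite lee_fin powR_ge0.
by rewrite -EFinD -EFinM lee_fin powR_modulusD.
Qed.

Lemma ellp_sumZ (a : K) x :
  (\sum_(k <oo) (modulus ((a *: x) k) `^ p%:num)%:E =
   (modulus a `^ p%:num)%:E * \sum_(k <oo) (modulus (x k) `^ p%:num)%:E)%E.
Proof.
rewrite -nneseriesZl; last by move=> *; rewrite lee_fin powR_ge0.
apply: eq_eseriesr => k _.
by rewrite -EFinM -powRM ?modulus_ge0// -modulusM.
Qed.

Lemma in_ellp_submod_closed : submod_closed in_ellp.
Proof.
split=> [|a x y]; rewrite !in_ellpE.
  by rewrite eseries0// => k _ _; rewrite modulus0 powR0// gt_eqF.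
move=> xp yp; apply: (le_lt_trans (ellp_sumD _ _)).
by rewrite lte_mul_pinfty ?lee_fin ?powR_ge0// lte_add_pinfty// ellp_sumZ
  lte_mul_pinfty ?lee_fin ?powR_ge0.
Qed.

HB.instance Definition _ :=
  GRing.isSubmodClosed.Build _ _ in_ellp in_ellp_submod_closed.

Record ellp : Type := EllP { ellp_seq : nat -> K^o; _ : ellp_seq \in in_ellp }.

HB.instance Definition _ := [isSub for ellp_seq].
HB.instance Definition _ := [Choice of ellp by <:].
HB.instance Definition _ := [SubChoice_isSubLmodule of ellp by <:].

Definition ellp_norm (x : ellp) : R := fine (ellp_Lnorm (ellp_seq x)).

Lemma ellp_fin_num (x : ellp) : ellp_Lnorm (ellp_seq x) \is a fin_num.
Proof. by rewrite ge0_fin_numE ?Lnorm_ge0//; case: x. Qed.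

Lemma ellp_norm_ge0 (x : ellp) : 0 <= ellp_norm x.
Proof. by rewrite fine_ge0// Lnorm_ge0. Qed.

Let sum_ge0 (x : nat -> K^o) :
  (0 <= \sum_(k <oo) (modulus (x k) `^ p%:num)%:E)%E.
Proof. by apply: nneseries_ge0 => k _ _; rewrite lee_fin powR_ge0. Qed.

Lemma ellp_norm_eq0 (x : ellp) : ellp_norm x = 0 -> x = 0.
Proof.
move=> x0; apply/val_inj/funext => k /=.
have /eqP : ellp_Lnorm (ellp_seq x) = 0%E.
  by rewrite -[LHS]fineK ?ellp_fin_num// -/(ellp_norm x) x0.
rewrite ellp_LnormE poweR_eq0// => /andP[/eqP S0 _].
have : ((modulus (ellp_seq x k) `^ p%:num)%:E <= 0)%E.
  rewrite -S0 (nneseriesD1 (n := k))//; last by move=> *; rewrite lee_fin powR_ge0.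
  by rewrite leeDl// nneseries_ge0// => *; rewrite lee_fin powR_ge0.
rewrite lee_fin => kS; have /eqP : modulus (ellp_seq x k) `^ p%:num = 0.
  by apply/eqP; rewrite eq_le kS powR_ge0.
by rewrite powR_eq0 => /andP[/eqP/modulus_eq0].
Qed.

Lemma ellp_normZ (a : K) (x : ellp) : ellp_norm (a *: x) = modulus a * ellp_norm x.
Proof.
rewrite /ellp_norm; apply: EFin_inj; rewrite EFinM !fineK ?ellp_fin_num//.
rewrite !ellp_LnormE ellp_sumZ poweRM ?lee_fin ?powR_ge0//.
by rewrite poweR_EFin -powRrM divff// powRr1// modulus_ge0.
Qed.

Lemma ellp_normD : exists C : R, forall x y : ellp,
  ellp_norm (x + y) <= C * (ellp_norm x + ellp_norm y).
Proof.
exists (2 * 2 `^ (p%:num)^-1) => x y.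
have q0 : 0 <= (p%:num)^-1 by rewrite invr_ge0.
rewrite -lee_fin EFinM EFinD !fineK ?ellp_fin_num// !ellp_LnormE.
set X : \bar R := (\sum_(k <oo) (modulus (ellp_seq x k) `^ _)%:E)%E.
set Y : \bar R := (\sum_(k <oo) (modulus (ellp_seq y k) `^ _)%:E)%E.
pose M : \bar R := Order.max X Y.
have M0 : (0 <= M)%E by rewrite le_max sum_ge0.
apply: (@le_trans _ _ (((2 `^ p%:num)%:E * (2%:E * M)) `^ (p%:num)^-1)%E).
  apply: gt0_ler_poweR => //; rewrite ?in_itv/= ?leey ?andbT//.
    by rewrite !mule_ge0// lee_fin powR_ge0.
  apply: (le_trans (ellp_sumD _ _)); rewrite lee_wpmul2l ?lee_fin ?powR_ge0//.
  by rewrite (mule_natl M 2) mule2n leeD// le_max lexx ?orbT.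
rewrite poweRM ?mule_ge0 ?lee_fin ?powR_ge0// poweR_EFin -powRrM divff//.
rewrite powRr1// poweRM// poweR_EFin muleA -EFinM.
rewrite lee_wpmul2l ?lee_fin ?mulr_ge0 ?powR_ge0//.
by rewrite /M; case: (leP X) => _; rewrite ?leeDl ?leeDr ?poweR_ge0.
Qed.

HB.instance Definition _ := @isQuasiNormed.Build R s ellp
  ellp_norm ellp_norm_ge0 ellp_norm_eq0 ellp_normZ ellp_normD.

Lemma ellp_normE (x : ellp) : qnorm x =
  fine (\sum_(k <oo) (modulus (ellp_seq x k) `^ p%:num)%:E)%E `^ (p%:num)^-1.
Proof. by rewrite /qnorm/= /ellp_norm ellp_LnormE fine_poweR. Qed.

Lemma ler_ellp_normD (x y : ellp) : 1 <= p%:num ->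
  qnorm (x + y) <= qnorm x + qnorm y.
Proof.
move=> p1; rewrite /qnorm/= -lee_fin EFinD !fineK ?ellp_fin_num//.
apply: (@le_trans _ _ (Lnorm counting (p%:num)%:E (EFin \o
    ((fun k => modulus (ellp_seq x k)) \+ (fun k => modulus (ellp_seq y k)))%R)));
  last exact: minkowski_EFin.
rewrite ellp_LnormE Lnorm_counting//.
apply: gt0_ler_poweR; rewrite ?invr_ge0// ?in_itv/= ?leey ?andbT//.
  by apply: nneseries_ge0 => k _ _; rewrite lee_fin powR_ge0.
apply: lee_nneseries => k *; rewrite lee_fin ?powR_ge0//=.
rewrite ger0_norm ?addr_ge0 ?modulus_ge0//.
by rewrite ge0_ler_powR ?nnegrE ?addr_ge0 ?modulus_ge0 ?ler_modulusD.
Qed.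

End ellp.

Section ellp_operators.
Context {R : realType} {s : scalar_kind}.
Let K := scalars R s.

Lemma in_ellp_subset (p q : {posnum R}) (x : nat -> K^o) :
  p%:num <= q%:num -> x \in in_ellp p -> x \in in_ellp q.
Proof.
move=> pq; rewrite !in_ellpE => xp.
set S := (\sum_(k <oo) _)%E in xp.
have Sfin : S \is a fin_num.
  by rewrite ge0_fin_numE// nneseries_ge0// => k _ _; rewrite lee_fin powR_ge0.
pose M := fine S `^ (p%:num)^-1.
have xM k : modulus (x k) <= M.
  have -> : modulus (x k) = (modulus (x k) `^ p%:num) `^ (p%:num)^-1.
    by rewrite -powRrM divff// powRr1// modulus_ge0.
  have kS : ((modulus (x k) `^ p%:num)%:E <= S)%E.
    rewrite /S (nneseriesD1 (n := k))//; last by move=> *; rewrite lee_fin powR_ge0.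
    by rewrite leeDl// nneseries_ge0// => *; rewrite lee_fin powR_ge0.
  have S0 : 0 <= fine S.
    by rewrite fine_ge0// (le_trans _ kS)// lee_fin powR_ge0.
  rewrite ge0_ler_powR ?invr_ge0 ?nnegrE ?powR_ge0//.
  by rewrite -lee_fin fineK.
apply: (@le_lt_trans _ _ ((M `^ (q%:num - p%:num))%:E * S)%E).
  rewrite -nneseriesZl; last by move=> *; rewrite lee_fin powR_ge0.
  apply: lee_nneseries => k *; first by rewrite lee_fin powR_ge0.
  rewrite -EFinM lee_fin -{1}(subrK p%:num q%:num) powRD; last first.
    by rewrite subrK gt_eqF.
  rewrite ler_wpM2r ?powR_ge0// ge0_ler_powR ?subr_ge0 ?nnegrE ?powR_ge0//.
  exact: modulus_ge0.
by rewrite lte_mul_pinfty ?lee_fin ?powR_ge0.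
Qed.

Definition ellp_incl (p q : {posnum R}) (pq : p%:num <= q%:num)
    (x : ellp s p) : ellp s q :=
  EllP (in_ellp_subset pq (valP x)).

Lemma ellp_incl_is_linear p q (pq : p%:num <= q%:num) :
  linear (@ellp_incl p q pq).
Proof. by move=> a x y; apply/val_inj/funext => k. Qed.

HB.instance Definition _ p q (pq : p%:num <= q%:num) :=
  GRing.isLinear.Build _ _ _ _ (@ellp_incl p q pq) (ellp_incl_is_linear pq).

Definition ellp_restrict (p q : {posnum R}) (pq : p%:num <= q%:num)
    (V : lmodType K) (T : {linear ellp s q -> V}) : {linear ellp s p -> V} :=
  T \o ellp_incl pq.

Variables (gamma : nat -> R).
Hypothesis gamma_ge0 : forall n, 0 <= gamma n.
Hypothesis gamma_noninc : nonincreasing_seq gamma.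

Lemma diag_in_ell2 (b : ellp s exp1) :
  (fun n => ellp_seq b n * of_real s (gamma n) : K^o) \in in_ellp exp2.
Proof.
have le12 : (exp1 : {posnum R})%:num <= exp2%:num by rewrite /= ler1n.
have := in_ellp_subset le12 (valP b); rewrite !in_ellpE /= => b2.
apply: (@le_lt_trans _ _ ((gamma 0 `^ 2)%:E *
    \sum_(k <oo) (modulus (ellp_seq b k) `^ 2)%:E)%E).
  rewrite -nneseriesZl; last by move=> *; rewrite lee_fin powR_ge0.
  apply: lee_nneseries => k *; first by rewrite lee_fin powR_ge0.
  rewrite -EFinM lee_fin modulusM modulus_of_real ger0_norm//.
  rewrite powRM ?modulus_ge0// mulrC ler_wpM2r ?powR_ge0//.
  by rewrite ge0_ler_powR ?nnegrE// gamma_noninc.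
by rewrite lte_mul_pinfty ?lee_fin ?powR_ge0.
Qed.

Definition diag_op (b : ellp s exp1) : ellp s exp2 := EllP (diag_in_ell2 b).

Lemma diag_op_is_linear : linear diag_op.
Proof.
by move=> a x y; apply/val_inj/funext => k /=; rewrite mulrDl -mulrA.
Qed.

HB.instance Definition _ :=
  GRing.isLinear.Build _ _ _ _ diag_op diag_op_is_linear.

End ellp_operators.

Arguments diag_op {R} s {gamma} gamma_ge0 gamma_noninc b.

(* Main.v *)
(** The restriction of an operator from l^1 to l^p has at most the same rank
    and the same error, as the unit ball of l^p lies in that of l^1.
    Conversely, the error of an operator A on l^p is at least the supremum over
    k of |(D - A) e_k|. Extend A from the unit vectors to an operator A' on l^1,
    A' x = sum_k x_k A e_k; a bounded operator from l^1 to a normed space has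
    norm sup_k |T e_k|, so the error of A' is at most that of A. To see that
    A' is well defined and has the rank of A, write the elements of the
    finite-dimensional range of A as v = sum_i v(k_i) d_i for suitable
    coordinates k_i; then the coordinate functionals of A are bounded on the
    unit vectors and each of them extends to l^1 as a series. *)

Require Import Defs.
From HB Require Import structures.
From mathcomp Require Import all_boot all_order all_algebra.
From mathcomp Require Import complex.
From mathcomp Require Import all_classical all_reals all_analysis.

Import Order.TTheory GRing.Theory Num.Theory.
Import numFieldNormedType.Exports.

Local Open Scope classical_set_scope.
Local Open Scope ring_scope.

Lemma modulus1 {R : realType} {s : scalar_kind} : modulus (1 : scalars R s) = 1.
Proof.
have /mulfI : modulus (1 : scalars R s) != 0.
  by apply: contra_neq (oner_neq0 (scalars R s)) => /modulus_eq0.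
by apply; rewrite -modulusM !mulr1.
Qed.

Lemma modulusN1 {R : realType} {s : scalar_kind} : modulus (- 1 : scalars R s) = 1.
Proof.
apply/eqP; rewrite -(@eqrXn2 _ 2) ?modulus_ge0// expr1n expr2 -modulusM.
by rewrite mulrNN mulr1 modulus1.
Qed.

(** * Finite-dimensional spaces *)

(** The added entry sits at [ord_max], the term that [big_ord_recr] splits off. *)
Definition ord_rcons {T : Type} {m : nat} (f : 'I_m -> T) (x : T) :
    'I_m.+1 -> T := fun i => oapp f x (unlift ord_max i).

Lemma ord_rcons_widen {T : Type} {m : nat} (f : 'I_m -> T) (x : T) (i : 'I_m) :
  ord_rcons f x (widen_ord (leqnSn m) i) = f i.
Proof.
rewrite /ord_rcons (_ : widen_ord _ i = lift ord_max i) ?liftK//.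
by apply: val_inj; rewrite /= /bump leqNgt ltn_ord.
Qed.

Lemma ord_rcons_max {T : Type} {m : nat} (f : 'I_m -> T) (x : T) :
  ord_rcons f x ord_max = x.
Proof. by rewrite /ord_rcons unlift_none. Qed.

Section finite_dimension.
Context {R : realType} {s : scalar_kind}.
Let K := scalars R s.

Definition lin_indep {V : lmodType K} {m : nat} (b : 'I_m -> V) : Prop :=
  forall c : 'I_m -> K, \sum_(i < m) c i *: b i = 0 -> forall i, c i = 0.

(** If [m < k], the [k] by [m] coefficient matrix has a nonzero row in its left kernel, whose
    entries form a nontrivial relation between the [v j]. *)
Lemma lin_indep_leq {V : lmodType K} {m k : nat} (b : 'I_m -> V)
    (v : 'I_k -> V) (a : 'I_k -> 'I_m -> K) :
  (forall j, v j = \sum_(i < m) a j i *: b i) -> lin_indep v -> (k <= m)%N.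
Proof.
move=> vE vfree; rewrite leqNgt; apply/negP => mk.
pose M : 'M[K]_(k, m) := \matrix_(j, i) a j i.
have : kermx M != 0.
  rewrite kermx_eq0 /row_free; apply: contraTneq mk => <-.
  by rewrite -leqNgt rank_leq_col.
case/rowV0Pn => u /sub_kermxP uM0 /eqP; apply; apply/rowP => j; rewrite mxE.
apply: (vfree (fun j => u 0 j)).
under eq_bigr => l _ do rewrite vE scaler_sumr.
rewrite exchange_big/= big1// => i _.
under eq_bigr => l _ do rewrite scalerA.
rewrite -scaler_suml; move/rowP: uM0 => /(_ i); rewrite !mxE.
under eq_bigr => l _ do rewrite mxE.
by move=> ->; rewrite scale0r.
Qed.

(** A linearly independent family in [S] of maximal length is a basis; [lin_indep_leq] bounds the
    lengths by [m]. This bounds ranks from a spanning family alone, even one that does not lie in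
    [S]. *)
Lemma has_dim_sub_span {V : lmodType K} {S : set V} {m : nat} (b : 'I_m -> V) :
  (forall v, S v -> exists c : 'I_m -> K, v = \sum_(i < m) c i *: b i) ->
  exists2 k, (k <= m)%N & has_dim S k.
Proof.
move=> Sb.
pose P k := `[< exists v : 'I_k -> V, (forall j, S (v j)) /\ lin_indep v >].
have P0 : exists k, P k.
  by exists 0%N; apply/asboolP; exists (fun=> 0); split=> [[]//|c _ []].
have Pm k : P k -> (k <= m)%N.
  case/asboolP => v [Sv]; have [a vE] := choice (fun j => Sb _ (Sv j)).
  exact: lin_indep_leq vE.
case: (ex_maxnP P0 Pm) => k Pk kmax; exists k; first exact: Pm.
have /asboolP[v [Sv vfree]] := Pk; exists v; split=> // w Sw.
have : ~ lin_indep (ord_rcons v w).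
  move=> wfree; suff /kmax : P k.+1 by rewrite ltnn.
  apply/asboolP; exists (ord_rcons v w); split=> // j.
  by rewrite /ord_rcons; case: unliftP => /=.
move=> /existsNP[c /not_implyP[]].
rewrite big_ord_recr/= ord_rcons_max.
under eq_bigr => i _ do rewrite ord_rcons_widen.
move=> c0 /existsNP[j cj].
(* Otherwise the relation would involve only the independent [v]. Dividing by this coefficient
   expresses [w] through [v]. *)
have cm : c ord_max != 0.
  apply: contra_notN cj => /eqP cm; move: c0; rewrite cm scale0r addr0.
  move=> /(vfree (fun i => c (widen_ord (leqnSn k) i))) c0.
  case: (unliftP ord_max j) => [i ->|->//].
  rewrite -[RHS](c0 i); congr c; apply: val_inj.
  by rewrite /= /bump leqNgt ltn_ord.
exists (fun i => - (c ord_max)^-1 * c (widen_ord (leqnSn k) i)).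
under eq_bigr => i _ do rewrite -scalerA.
by rewrite -scaler_sumr scaleNr -scalerN (addr0_eq c0) scalerA mulVf// scale1r.
Qed.

(* Coefficients with respect to [d] are values of the functionals [ev], hence
   bounded without an appeal to the equivalence of norms in finite dimension.
   Gaussian elimination: a new vector [b] minus its interpolant is either zero
   or nonzero at some [l], which becomes the next index. *)
Lemma interpolating_family {V : lmodType K} (ev : nat -> {linear V -> K^o})
    {m : nat} (b : 'I_m -> V) :
  (forall v, (forall k, ev k v = 0) -> v = 0) ->
  exists (k : 'I_m -> nat) (d : 'I_m -> V), forall c : 'I_m -> K,
    let v := \sum_(i < m) c i *: b i in v = \sum_(i < m) ev (k i) v *: d i.
Proof.
move=> ev0; elim: m b => [|m IHm] b.
  by exists (fun=> 0%N), (fun=> 0) => c /=; rewrite !big_ord0.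
have [k [d bd]] := IHm (fun i => b (widen_ord (leqnSn m) i)).
pose P v := \sum_(i < m) ev (k i) v *: d i.
have PD a u v : P (u + a *: v) = P u + a *: P v.
  rewrite /P scaler_sumr -big_split; apply: eq_bigr => i _ /=.
  by rewrite linearD linearZ/= scalerDl scalerA.
pose g := b ord_max - P (b ord_max).
(* By induction [P] fixes the span of the first [m] vectors, so only the last one contributes to
   [v - P v]. *)
have decomp c : let v := \sum_(i < m.+1) c i *: b i in
    v = P v + c ord_max *: g.
  rewrite /= big_ord_recr/= PD -[X in X + _ + _]bd.
  by rewrite -addrA -scalerDr /g [P (b _) + _]addrC subrK.
have [g0|/existsNP[l gl]] := pselect (forall k, ev k g = 0).
  (* Here [g = 0]; the index 0 is padding, paired with the zero vector. *)
  exists (ord_rcons k 0%N), (ord_rcons d 0) => c.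
  have := decomp c; rewrite /= (ev0 _ g0) scaler0 addr0 => {1}->.
  rewrite [RHS]big_ord_recr/= !ord_rcons_max scaler0 addr0.
  by apply: eq_bigr => i _; rewrite !ord_rcons_widen.
move/eqP in gl.
(* The old [d i] are corrected by multiples of [g] so as to vanish at [l], and [g] is scaled to the
   value 1 there. *)
exists (ord_rcons k l),
  (ord_rcons (fun i => d i - (ev l (d i) / ev l g) *: g) ((ev l g)^-1 *: g)).
move=> c v; have vE : v = P v + c ord_max *: g := decomp c.
rewrite [RHS]big_ord_recr/= !ord_rcons_max.
under eq_bigr => i _ do rewrite !ord_rcons_widen scalerBr.
rewrite sumrB -/(P v) {1}vE -addrA; congr (_ + _).
(* Evaluating the decomposition at [l] determines the last coefficient. *)
have -> : c ord_max = (ev l v - ev l (P v)) / ev l g.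
  by rewrite {1}vE linearD linearZ/= addrC addKr mulfK.
rewrite addrC scalerA mulrBl scalerBl; congr (_ - _).
rewrite /P linear_sum/= mulr_suml scaler_suml; apply: eq_bigr => i _.
by rewrite linearZ/= scalerA mulrA.
Qed.

End finite_dimension.

(** * Absolutely convergent series of scalars *)

Section scalar_sum.
Context {R : realType} {s : scalar_kind}.
Let K := scalars R s.

Definition rsum (u : nat -> R) : R := limn (series u).

(* Real and imaginary parts reduce everything to the completeness of [R]. The
   value is junk if the series diverges. *)
Definition scalar_sum (u : nat -> K) : K :=
  match s return (nat -> scalars R s) -> scalars R s with
  | RealScalars => fun u => rsum u
  | ComplexScalars => fun u =>
      (rsum (fun k => complex.Re (u k)) +i* rsum (fun k => complex.Im (u k)))%C
  end u.

Definition summable_scalars (u : nat -> K) : Prop :=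
  cvgn (series (fun k => modulus (u k))).

End scalar_sum.

Section real_sums.
Context {R : realType}.
Implicit Types u v w : nat -> R.

Lemma dominated_cvg_series u v : (forall k, `|u k| <= v k) ->
  cvgn (series v) -> cvgn (series u).
Proof.
move=> uv cv; apply: normed_cvg; apply: (@series_le_cvg _ _ v) => // n.
  exact: normr_ge0.
by apply: le_trans (uv n).
Qed.

Lemma rsumD u v : cvgn (series u) -> cvgn (series v) ->
  rsum (fun k => u k + v k) = rsum u + rsum v.
Proof. exact: lim_seriesD. Qed.

Lemma rsumZ a u : cvgn (series u) -> rsum (fun k => a * u k) = a * rsum u.
Proof. by move=> cu; rewrite /rsum -[RHS](lim_seriesZ (V := R^o) (f := u)). Qed.

(** The real and imaginary parts of a complex [a * u k + v k] both have this shape. *)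
Lemma rsum_comb a b u v w :
  cvgn (series u) -> cvgn (series v) -> cvgn (series w) ->
  rsum (fun k => a * u k + b * v k + w k) = a * rsum u + b * rsum v + rsum w.
Proof.
move=> cu cv cw.
have cau : cvgn (series (fun k => a * u k)) by exact: (is_cvg_seriesZ (V := R^o)).
have cbv : cvgn (series (fun k => b * v k)) by exact: (is_cvg_seriesZ (V := R^o)).
rewrite (rsumD (fun k => a * u k + b * v k) w)//; last exact: is_cvg_seriesD.
by rewrite (rsumD (fun k => a * u k) (fun k => b * v k))// !rsumZ.
Qed.

Lemma rsum_bound u v : (forall k, `|u k| <= v k) -> cvgn (series v) ->
  `|rsum u| <= rsum v.
Proof.
move=> uv cv; have cu : cvgn (series (fun k => `|u k|)).
  by apply: dominated_cvg_series cv => k; rewrite normr_id.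
apply: (le_trans (lim_series_norm cu)); exact: lim_series_le.
Qed.

(** The partial sums are constant once they include the index [j]. *)
Lemma rsum_single u j : (forall k, k != j -> u k = 0) -> rsum u = u j.
Proof.
move=> u0; apply: lim_near_cst => //; near=> N.
have jN : (j < N)%N by near: N; exact: nbhs_infty_gt.
rewrite /series/= big_mkord (bigD1 (Ordinal jN))//= big1 ?addr0// => i ij.
by apply: u0; apply: contra_neq ij => ?; exact: val_inj.
Unshelve. all: by end_near. Qed.

End real_sums.

Section complex_parts.
Context {R : realType}.

Lemma norm_Re_le (z : R[i]) : `|complex.Re z| <= Normc.normc z.
Proof.
case: z => a b /=; rewrite -sqrtr_sqr ler_sqrt ?lerDl ?sqr_ge0//.
by rewrite addr_ge0 ?sqr_ge0.
Qed.

Lemma norm_Im_le (z : R[i]) : `|complex.Im z| <= Normc.normc z.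
Proof.
case: z => a b /=; rewrite -sqrtr_sqr ler_sqrt ?lerDr ?sqr_ge0//.
by rewrite addr_ge0 ?sqr_ge0.
Qed.

Lemma normc_le_ReIm (z : R[i]) :
  Normc.normc z <= `|complex.Re z| + `|complex.Im z|.
Proof.
case: z => a b /=; rewrite -[leRHS]ger0_norm ?addr_ge0// -sqrtr_sqr.
rewrite ler_sqrt ?sqr_ge0// sqrrD !real_normK ?num_real// addrAC.
by rewrite lerDl mulrn_wge0// mulr_ge0.
Qed.

End complex_parts.

Section scalar_sum_theory.
Context {R : realType} {s : scalar_kind}.
Implicit Types u v : nat -> scalars R s.

(** In the complex case the real and imaginary parts are dominated by the moduli, so all four real
    series converge and can be combined. *)
Lemma scalar_sum_linear (a : scalars R s) u v :
  summable_scalars u -> summable_scalars v ->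
  scalar_sum (fun k => a * u k + v k) = a * scalar_sum u + scalar_sum v.
Proof.
rewrite /summable_scalars /scalar_sum; case: s a u v => /= a u v cu cv.
  have cu' : cvgn (series u) by exact: dominated_cvg_series cu.
  have cv' : cvgn (series v) by exact: dominated_cvg_series cv.
  rewrite (rsumD (fun k => a * u k) v)// ?rsumZ//.
  exact: (is_cvg_seriesZ (V := R^o)).
have cRu : cvgn (series (fun k => complex.Re (u k))).
  by apply: dominated_cvg_series cu => k; exact: norm_Re_le.
have cIu : cvgn (series (fun k => complex.Im (u k))).
  by apply: dominated_cvg_series cu => k; exact: norm_Im_le.
have cRv : cvgn (series (fun k => complex.Re (v k))).
  by apply: dominated_cvg_series cv => k; exact: norm_Re_le.
have cIv : cvgn (series (fun k => complex.Im (v k))).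
  by apply: dominated_cvg_series cv => k; exact: norm_Im_le.
case: a => x y.
have -> : (fun k => complex.Re ((x +i* y)%C * u k + v k)) = (fun k =>
    (x * complex.Re (u k) + - y * complex.Im (u k)) + complex.Re (v k)).
  by apply/funext => k; case: (u k) (v k) => [? ?] [? ?] /=; rewrite mulNr.
have -> : (fun k => complex.Im ((x +i* y)%C * u k + v k)) = (fun k =>
    (x * complex.Im (u k) + y * complex.Re (u k)) + complex.Im (v k)).
  by apply/funext => k; case: (u k) (v k) => [? ?] [? ?] /=.
rewrite (rsum_comb x (- y) _ _ _ cRu cIu cRv) (rsum_comb x y _ _ _ cIu cRu cIv).
by rewrite mulNr.
Qed.

(** The factor 2 comes from adding the bounds for the real and imaginary parts. It is harmless: the
    bound only serves to show that operators are bounded, not to estimate errors. *)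
Lemma scalar_sum_bound u : summable_scalars u ->
  modulus (scalar_sum u) <= 2 * rsum (fun k => modulus (u k)).
Proof.
rewrite /summable_scalars /scalar_sum; case: s u => u cu.
  rewrite /= mulr_natl mulr2n (le_trans (rsum_bound _ _ (fun=> lexx _) cu))//.
  rewrite lerDl; apply: le_trans (rsum_bound _ _ (fun=> lexx _) cu).
  exact: normr_ge0.
apply: (le_trans (normc_le_ReIm _)); rewrite mulr_natl mulr2n.
by apply: lerD; apply: rsum_bound => // k; [exact: norm_Re_le|exact: norm_Im_le].
Qed.

Lemma scalar_sum_single u j : (forall k, k != j -> u k = 0) ->
  scalar_sum u = u j.
Proof.
rewrite /scalar_sum; case: s u => /= u u0; first exact: rsum_single.
rewrite (rsum_single _ j) => [|k /u0 ->//].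
by rewrite (rsum_single _ j) => [|k /u0 ->//]; case: (u j).
Qed.

End scalar_sum_theory.

(** * Truncation in the sequence spaces *)

Section ellp_facts.
Context {R : realType} {s : scalar_kind}.
Let K := scalars R s.
Local Notation ell1 := (@ellp R s exp1).

Lemma ellp_sum_fin_num {p : {posnum R}} (x : ellp s p) :
  (\sum_(k <oo) (modulus (ellp_seq x k) `^ p%:num)%:E)%E \is a fin_num.
Proof.
rewrite ge0_fin_numE; last by apply: nneseries_ge0 => *; rewrite lee_fin powR_ge0.
by have := valP x; rewrite in_ellpE.
Qed.

Lemma ellp_norm_powR {p : {posnum R}} (x : ellp s p) :
  ((qnorm x `^ p%:num)%:E =
   \sum_(k <oo) (modulus (ellp_seq x k) `^ p%:num)%:E)%E.
Proof.
rewrite ellp_normE -powRrM mulVf// powRr1 ?fineK ?ellp_sum_fin_num//.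
by rewrite fine_ge0// nneseries_ge0// => *; rewrite lee_fin powR_ge0.
Qed.

Lemma ellp_norm_le_sum {p : {posnum R}} (x : ellp s p) (M : R) : 0 <= M ->
  (\sum_(k <oo) (modulus (ellp_seq x k) `^ p%:num)%:E <= (M `^ p%:num)%:E)%E ->
  qnorm x <= M.
Proof.
move=> M0; rewrite -ellp_norm_powR lee_fin => xM.
rewrite -(powRr1 M0) -(powRr1 (qnorm_ge0 x)) -(@mulfV _ p%:num)// !powRrM.
by rewrite ge0_ler_powR ?nnegrE ?powR_ge0 ?invr_ge0.
Qed.

Lemma modulus_le_ellp_norm {p : {posnum R}} (x : ellp s p) (k : nat) :
  modulus (ellp_seq x k) <= qnorm x.
Proof.
rewrite -(powRr1 (modulus_ge0 _)) -(powRr1 (qnorm_ge0 x)) -(@mulfV _ p%:num)//.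
rewrite !powRrM ge0_ler_powR ?nnegrE ?powR_ge0 ?invr_ge0// -lee_fin.
rewrite ellp_norm_powR (nneseriesD1 (n := k))//; last first.
  by move=> *; rewrite lee_fin powR_ge0.
by rewrite leeDl// nneseries_ge0// => *; rewrite lee_fin powR_ge0.
Qed.

(** Since [|x_k| <= ||x||_p], one has [|x_k|^q <= ||x||_p^(q-p) |x_k|^p]; summing over [k] gives
    [||x||_p^q] on the right. *)
Lemma ellp_incl_norm {p q : {posnum R}} (pq : p%:num <= q%:num) (x : ellp s p) :
  qnorm (ellp_incl pq x) <= qnorm x.
Proof.
apply: ellp_norm_le_sum; first exact: qnorm_ge0.
rewrite -{2}(subrK p%:num q%:num) powRD; last by rewrite subrK gt_eqF.
rewrite EFinM ellp_norm_powR -nneseriesZl; last first.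
  by move=> *; rewrite lee_fin powR_ge0.
apply: lee_nneseries => k *; first by rewrite lee_fin powR_ge0.
rewrite -EFinM lee_fin -{1}(subrK p%:num q%:num) powRD; last first.
  by rewrite subrK gt_eqF.
rewrite ler_wpM2r ?powR_ge0// ge0_ler_powR ?subr_ge0 ?nnegrE ?modulus_ge0 ?qnorm_ge0//.
exact: (modulus_le_ellp_norm x).
Qed.

Definition unit_fun (k : nat) : nat -> K^o := fun i => (i == k)%:R.

Lemma unit_fun_sum (p : {posnum R}) (k : nat) :
  (\sum_(i <oo) (modulus (unit_fun k i) `^ p%:num)%:E = 1)%E.
Proof.
rewrite (nneseriesD1 (n := k))//; last by move=> *; rewrite lee_fin powR_ge0.
rewrite /unit_fun eqxx modulus1 powR1 eseries_mkcond/= eseries0 ?adde0// => i _ _.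
by case: eqVneq => //= _; rewrite modulus0 powR0 ?gt_eqF.
Qed.

Lemma unit_fun_in (p : {posnum R}) (k : nat) : unit_fun k \in in_ellp p.
Proof. by rewrite in_ellpE unit_fun_sum ltry. Qed.

Definition ellp_unit (p : {posnum R}) (k : nat) : ellp s p := EllP (unit_fun_in p k).

Lemma ellp_unit_norm (p : {posnum R}) (k : nat) : qnorm (ellp_unit p k) = 1.
Proof. by rewrite ellp_normE/= unit_fun_sum /= powR1. Qed.

Lemma ellp_incl_unit {p q : {posnum R}} (pq : p%:num <= q%:num) (k : nat) :
  ellp_incl pq (ellp_unit p k) = ellp_unit q k.
Proof. exact/val_inj. Qed.

(** A named coordinate map can carry a linear structure, as [interpolating_family] and [linear_sum]
    require. *)
Definition ellp_eval {p : {posnum R}} (k : nat) (x : ellp s p) : K^o := ellp_seq x k.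

Lemma ellp_eval_is_linear (p : {posnum R}) (k : nat) : linear (@ellp_eval p k).
Proof. by []. Qed.

HB.instance Definition _ (p : {posnum R}) (k : nat) :=
  GRing.isLinear.Build _ _ _ _ (@ellp_eval p k) (@ellp_eval_is_linear p k).

Lemma ell1_norm_sum (x : ell1) :
  ((qnorm x)%:E = \sum_(k <oo) (modulus (ellp_seq x k))%:E)%E.
Proof.
rewrite -[qnorm x]powRr1 ?qnorm_ge0// ellp_norm_powR.
by apply: eq_eseriesr => k _; rewrite powRr1// modulus_ge0.
Qed.

Definition ellp_trunc {p : {posnum R}} (x : ellp s p) (N : nat) : ellp s p :=
  \sum_(k < N) ellp_seq x k *: ellp_unit p k.

Lemma ellp_truncE {p : {posnum R}} (x : ellp s p) (N i : nat) :
  ellp_seq (ellp_trunc x N) i = if (i < N)%N then ellp_seq x i else 0.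
Proof.
rewrite -[LHS]/(ellp_eval i (ellp_trunc x N)) /ellp_trunc linear_sum.
under eq_bigr do rewrite linearZ/=.
case: ifPn => [iN|].
  rewrite (bigD1 (Ordinal iN))//= big1 => [|j ji].
    by rewrite addr0 /ellp_eval /= /unit_fun eqxx [LHS]mulr1.
  rewrite /ellp_eval/= /unit_fun [_ == _]negbTE ?scaler0//.
  by apply: contra_neq ji => ij; apply: val_inj.
rewrite -leqNgt => Ni; rewrite big1// => j _.
by rewrite /ellp_eval/= /unit_fun gtn_eqF ?scaler0// (leq_trans _ Ni).
Qed.

Lemma ell1_trunc_norm (x : ell1) (N : nat) :
  qnorm x = \sum_(k < N) modulus (ellp_seq x k) + qnorm (x - ellp_trunc x N).
Proof.
have mod0 (z : K) : (0 <= (modulus z)%:E)%E by rewrite lee_fin modulus_ge0.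
have tailE k : ellp_seq (x - ellp_trunc x N) k =
    if (k < N)%N then 0 else ellp_seq x k.
  rewrite -[LHS]/(ellp_seq x k - ellp_seq (ellp_trunc x N) k) ellp_truncE.
  by case: ifP; rewrite ?subrr ?subr0.
apply: EFin_inj; rewrite EFinD !ell1_norm_sum.
rewrite (nneseries_split 0 N)// add0n sumEFin big_mkord; congr (_ + _)%E.
rewrite [RHS](nneseries_split 0 N)// add0n big_nat big1 ?add0e => [|k /andP[_ kN]].
  rewrite eseries_cond [RHS]eseries_cond; apply: eq_eseriesr => k /andP[_ Nk].
  by rewrite tailE ltnNge Nk.
by rewrite tailE kN modulus0.
Qed.

(** The norm is the supremum of the partial sums of moduli, so one of them exceeds [qnorm x - e]; by
    [ell1_trunc_norm] the tail is the remainder. *)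
Lemma ell1_trunc_cvg (x : ell1) (e : R) : 0 < e ->
  exists N, qnorm (x - ellp_trunc x N) < e.
Proof.
move=> e0.
have /cvg_lim supE : eseries (fun k => (modulus (ellp_seq x k))%:E) @ \oo -->
    ereal_sup (range (eseries (fun k => (modulus (ellp_seq x k))%:E))).
  apply: ereal_nondecreasing_cvgn; apply: ereal_nondecreasing_series => *.
  by rewrite lee_fin modulus_ge0.
have : ((qnorm x - e)%:E < ereal_sup
    (range (eseries (fun k => (modulus (ellp_seq x k))%:E))))%E.
  by rewrite -supE// -[lim _]ell1_norm_sum lte_fin ltrBlDr ltrDl.
move=> /ereal_sup_gt[_ [N _ <-]]; rewrite /eseries/= sumEFin lte_fin big_mkord.
rewrite {1}(ell1_trunc_norm x N) => xN; exists N.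
by move: xN; rewrite ltrBlDr ltrD2l.
Qed.

(** The triangle inequality gives the bound on truncations. Boundedness of [T] makes the
    contribution of the tail arbitrarily small, so its constant [C] does not enter the result. *)
Lemma ell1_le_of_unit {X : quasiNormedType R s} (T : {linear ell1 -> X})
    (M : R) :
  (forall u v : X, qnorm (u + v) <= qnorm u + qnorm v) ->
  bounded_operator T -> (forall k, qnorm (T (ellp_unit exp1 k)) <= M) ->
  forall x, qnorm (T x) <= M * qnorm x.
Proof.
move=> XD [C TC] TM x.
have M0 : 0 <= M := le_trans (qnorm_ge0 _) (TM 0%N).
have TN N : qnorm (T (ellp_trunc x N)) <= M * qnorm x.
  apply: (@le_trans _ _ (M * \sum_(k < N) modulus (ellp_seq x k))); last first.
    by rewrite ler_wpM2l// (ell1_trunc_norm x N) lerDl qnorm_ge0.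
  rewrite /ellp_trunc; elim: N => [|N IHN].
    rewrite !big_ord0 linear0 mulr0 -(scale0r 0) qnormZ.
    by rewrite modulus0 mul0r.
  rewrite !big_ord_recr/= linearD linearZ/= mulrDr (le_trans (XD _ _))//.
  by rewrite lerD// qnormZ mulrC ler_wpM2r ?modulus_ge0.
apply/ler_addgt0Pr => e e0.
(* The sign of [C] is unknown; this positive majorant can be divided by. *)
have C0 : 0 < `|C| + 1 by rewrite ltr_wpDl.
have [N xN] := ell1_trunc_cvg x _ (divr_gt0 e0 C0).
rewrite -[in leLHS](subrK (ellp_trunc x N) x) linearD addrC.
rewrite (le_trans (XD _ _))// lerD// (le_trans (TC _))//.
rewrite (@le_trans _ _ ((`|C| + 1) * qnorm (x - ellp_trunc x N)))//.
  by rewrite ler_wpM2r ?qnorm_ge0// (le_trans (ler_norm C))// lerDl.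
by rewrite mulrC -ler_pdivlMr// ltW.
Qed.

End ellp_facts.

(** * Extension from the unit vectors *)

Section extension.
Context {R : realType} {s : scalar_kind}.
Local Notation ell1 := (@ellp R s exp1).
Local Notation K := (scalars R s).

Lemma cvg_ell1_series (x : ell1) :
  cvgn (series (fun k => modulus (ellp_seq x k))).
Proof.
apply: nnseries_is_cvg => [k|]; first exact: modulus_ge0.
by rewrite -ell1_norm_sum ltry.
Qed.

Lemma ell1_norm_rsum (x : ell1) : qnorm x = rsum (fun k => modulus (ellp_seq x k)).
Proof.
apply: EFin_inj; rewrite ell1_norm_sum /rsum -EFin_lim; last exact: cvg_ell1_series.
by apply: congr_lim; apply/funext => N /=; rewrite /series/= sumEFin.
Qed.

(** The functional is the series of [x_k c_k], dominated by [C] times the series of [|x_k|]; the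
    factor 2 is that of [scalar_sum_bound]. *)
Lemma ell1_functional (c : nat -> K) (C : R) : (forall k, modulus (c k) <= C) ->
  exists psi : {linear ell1 -> K^o},
    (forall x, modulus (psi x) <= 2 * C * qnorm x) /\
    (forall k, psi (ellp_unit exp1 k) = c k).
Proof.
move=> cC.
have C0 : 0 <= C := le_trans (modulus_ge0 _) (cC 0%N).
pose f (x : ell1) : K^o := scalar_sum (fun k => ellp_seq x k * c k).
have le_dom (x : ell1) k :
    `|modulus (ellp_seq x k * c k)| <= C * modulus (ellp_seq x k).
  by rewrite ger0_norm ?modulus_ge0// modulusM mulrC ler_wpM2r ?modulus_ge0.
have cvg_dom (x : ell1) : cvgn (series (fun k => C * modulus (ellp_seq x k))).
  by apply: (is_cvg_seriesZ (V := R^o)); exact: cvg_ell1_series.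
have summ (x : ell1) : summable_scalars (fun k => ellp_seq x k * c k).
  exact: dominated_cvg_series (le_dom x) (cvg_dom x).
have flin : linear f.
  move=> a x y; rewrite /f -[RHS](scalar_sum_linear _ _ _ (summ x) (summ y)).
  by congr scalar_sum; apply/funext => k /=; rewrite mulrDl -mulrA.
pose F : {linear ell1 -> K^o} := HB.pack f (GRing.isLinear.Build _ _ _ _ f flin).
exists F; split=> [x|k].
  apply: (le_trans (scalar_sum_bound _ (summ x))).
  rewrite -mulrA ler_wpM2l// ell1_norm_rsum -rsumZ; last exact: cvg_ell1_series.
  apply: le_trans (rsum_bound _ _ (le_dom x) (cvg_dom x)); exact: ler_norm.
rewrite [LHS](scalar_sum_single _ k) /= /unit_fun ?eqxx ?mul1r// => i ik.
by rewrite (negbTE ik) mul0r.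
Qed.

Lemma bounded_operator_sum {F X : quasiNormedType R s} {m : nat}
    (psi : 'I_m -> {linear F -> K^o}) (d : 'I_m -> X) (T : {linear F -> X}) :
  (forall u v : X, qnorm (u + v) <= qnorm u + qnorm v) ->
  (forall i, exists C, forall x, modulus (psi i x) <= C * qnorm x) ->
  (forall x, T x = \sum_(i < m) psi i x *: d i) -> bounded_operator T.
Proof.
move=> XD /choice[C psiC] TE; exists (\sum_(i < m) C i * qnorm (d i)) => x.
rewrite {}TE mulr_suml; elim/big_ind2: _ => [|a u b v ua vb|i _].
- by rewrite -(scale0r 0) qnormZ modulus0 mul0r.
- exact: le_trans (XD _ _) (lerD ua vb).
- by rewrite qnormZ mulrAC ler_wpM2r ?qnorm_ge0.
Qed.

Lemma ell1_extension {p q : {posnum R}} (A : {linear ellp s p -> ellp s q}) (n : nat) :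
  1 <= q%:num -> bounded_operator A -> rank_le A n ->
  exists A' : {linear ell1 -> ellp s q},
    [/\ bounded_operator A', rank_le A' n &
        forall k, A' (ellp_unit exp1 k) = A (ellp_unit p k)].
Proof.
move=> q1 [C AC] [m mn [b [_ _ Ab]]].
have sep (v : ellp s q) : (forall k, ellp_eval k v = 0) -> v = 0.
  by move=> v0; apply/val_inj/funext => k; exact: v0.
have [k [d dE]] := interpolating_family (fun k => ellp_eval k : {linear _ -> _}) b sep.
have AE x : A x = \sum_(i < m) ellp_eval (k i) (A x) *: d i.
  by have [|c ->] := Ab (A x); [exists x|exact: dE].
(* A coordinate is at most the norm, and the unit vectors have norm 1 in every [ellp], so the
   constant of [A] bounds all coefficients. *)
have AkC i j : modulus (ellp_eval (k i) (A (ellp_unit p j))) <= C.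
  by rewrite (le_trans (modulus_le_ellp_norm _ _))// (le_trans (AC _))//
    ellp_unit_norm mulr1.
have [psi psiE] := choice (fun i => ell1_functional _ _ (AkC i)).
pose f x := \sum_(i < m) psi i x *: d i.
have flin : linear f.
  move=> a x y; rewrite /f scaler_sumr -big_split; apply: eq_bigr => i _ /=.
  by rewrite linearP scalerDl scalerA.
pose F : {linear ell1 -> ellp s q} := HB.pack f (GRing.isLinear.Build _ _ _ _ f flin).
exists F; split.
- apply: (bounded_operator_sum psi d) => // [u v|i]; first exact: ler_ellp_normD.
  by exists (2 * C) => x; have [] := psiE i.
(* The range of [F] lies in the span of the [m] vectors [d i], and [m <= n]. *)
- have [|m' m'm] := @has_dim_sub_span _ _ _ (range F) _ d.
    by move=> _ [x _ <-]; exists (fun i => psi i x).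
  by exists m' => //; exact: leq_trans mn.
- move=> j; rewrite [LHS]/= /f [RHS]AE; apply: eq_bigr => i _.
  by have [_ ->] := psiE i.
Qed.

End extension.

(** * Boundedness of the diagonal operator and the two inequalities *)

(** Each [gamma k] is at most [gamma 0], and the 2-norm is at most the 1-norm. *)
Lemma diag_op_bounded {R : realType} {s : scalar_kind} {gamma : nat -> R}
    (gamma_ge0 : forall k : nat, 0 <= gamma k)
    (gamma_noninc : nonincreasing_seq gamma) :
  bounded_operator (diag_op s gamma_ge0 gamma_noninc).
Proof.
have le12 : (exp1 : {posnum R})%:num <= exp2%:num by rewrite /= ler1n.
exists (gamma 0%N) => x.
apply: (@le_trans _ _ (gamma 0%N * qnorm (ellp_incl le12 x))); last first.
  by rewrite ler_wpM2l// ellp_incl_norm.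
apply: ellp_norm_le_sum; first by rewrite mulr_ge0// qnorm_ge0.
rewrite powRM// ?qnorm_ge0// EFinM ellp_norm_powR -nneseriesZl; last first.
  by move=> *; rewrite lee_fin powR_ge0.
apply: lee_nneseries => k *; first by rewrite lee_fin powR_ge0.
rewrite -EFinM lee_fin modulusM modulus_of_real ger0_norm//.
rewrite powRM ?modulus_ge0// mulrC ler_wpM2r ?powR_ge0//.
by rewrite ge0_ler_powR ?nnegrE// gamma_noninc.
Qed.

Lemma bounded_operatorB {R : realType} {s : scalar_kind} {F X : quasiNormedType R s}
    (S T : {linear F -> X}) :
  (forall u v : X, qnorm (u + v) <= qnorm u + qnorm v) ->
  bounded_operator S -> bounded_operator T ->
  bounded_operator (S \- T : {linear F -> X}).
Proof.
move=> XD [C SC] [C' TC]; exists (C + C') => x /=.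
rewrite (le_trans (XD _ _))// mulrDl lerD//.
by rewrite -scaleN1r qnormZ modulusN1 mul1r.
Qed.

Theorem theorem4p11 (R : realType) (s : scalar_kind) (gamma : nat -> R)
    (gamma_ge0 : forall k : nat, 0 <= gamma k)
    (gamma_noninc : nonincreasing_seq gamma)
    (p : {posnum R}) (p_le1 : p%:num <= 1) (n : nat) :
  let D : {linear ellp s exp1 -> ellp s exp2} :=
    diag_op s gamma_ge0 gamma_noninc in
  let Dp : {linear ellp s p -> ellp s exp2} := ellp_restrict (q := exp1) p_le1 D in
  approx_number Dp n = approx_number D n.
Proof.
move=> D Dp.
have ge1 : 1 <= (exp2 : {posnum R})%:num by rewrite /= ler1n.
have XD (u v : @ellp R s exp2) : qnorm (u + v) <= qnorm u + qnorm v.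
  exact: ler_ellp_normD.
apply/eqP; rewrite eq_le; apply/andP; split;
  apply: le_ereal_inf_tmp => _ [A [[C AC] Arank] <-].
  (* For [a_n(D^p) <= a_n(D)], the competitor is the restriction of [A]. *)
  pose A' : {linear ellp s p -> ellp s exp2} := ellp_restrict (q := exp1) p_le1 A.
  have incl1 (x : ellp s p) : qnorm (ellp_incl (q := exp1) p_le1 x) <= qnorm x.
    exact: ellp_incl_norm.
  apply: ge_ereal_inf; eexists.
    exists A' => //; split.
      exists `|C| => x; rewrite (le_trans (AC _))//.
      rewrite (le_trans (ler_wpM2r (qnorm_ge0 _) (ler_norm C)))//.
      by rewrite ler_wpM2l// incl1.
    (* The range of the restriction may be smaller than that of [A], so it needs a basis of its
       own. *)
    have [m mn [b [_ _ Ab]]] := Arank.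
    have [|m' m'm] := @has_dim_sub_span _ _ _ (range A') _ b.
      by move=> _ [x _ <-]; apply: Ab; exists (ellp_incl (q := exp1) p_le1 x).
    by exists m' => //; exact: leq_trans mn.
  apply: ge_ereal_sup => _ [f /= f1 <-]; apply: ereal_sup_ubound.
  by exists (ellp_incl (q := exp1) p_le1 f) => //=; rewrite (le_trans (incl1 f)).
(* For [a_n(D) <= a_n(D^p)], the competitor is the extension of [A] from the unit vectors. *)
have [A' [A'bd A'rank A'E]] := ell1_extension A n ge1 (ex_intro _ C AC) Arank.
apply: ge_ereal_inf; eexists.
  by exists A'.
(* [M] is the error of [A] on the unit ball of [ellp s p]. This ball contains the unit vectors,
   where [D - A'] takes the same values as [Dp - A]. *)
set M := (X in (_ <= X)%E).
have unitM k : ((qnorm (D (ellp_unit exp1 k) - A' (ellp_unit exp1 k)))%:E <= M)%E.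
  apply: ereal_sup_ubound; exists (ellp_unit p k); first by rewrite /= ellp_unit_norm.
  by rewrite /Dp /= ellp_incl_unit A'E.
have DA'bd : bounded_operator (D \- A' : {linear _ -> _}).
  by apply: bounded_operatorB => //; exact: diag_op_bounded.
apply: ge_ereal_sup => _ [f /= f1 <-].
(* For [M = +oo] the bound is trivial; [M = -oo] is impossible, as [M] dominates a norm. *)
clearbody M; case: M unitM => [r| |] unitM; rewrite ?leey//; last by have := unitM 0%N.
have r0 : 0 <= r by rewrite -lee_fin (le_trans _ (unitM 0%N))// lee_fin qnorm_ge0.
rewrite lee_fin; apply: (le_trans (ell1_le_of_unit _ r XD DA'bd unitM f)).
by rewrite -[leRHS]mulr1 ler_wpM2l.
Qed.
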